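(* Let $k\ge 1$, $N=\mathbb{R}^{n+1}$ with $n\le 6$, and let $\Omega\subset\mathbb{R}^{n+1}$ be a bounded, open set with smooth boundary such that $H_{\partial\Omega}>0$. Then the weak $H^k$-flow generated by $\Omega$ is unique; that is, any two weak $H^k$-flows generated by $\Omega$ coincide.
   Context: Mean curvature $H$ is taken with respect to the outer unit normal $\nu$, with $-H\nu$ the mean curvature vector. Weak $H^k$-flow: for $\varepsilon>0$ consider $$(\star\star)_\varepsilon:\quad \mathrm{div}\Big(\frac{\nabla u^\varepsilon}{\sqrt{\varepsilon^2+|\nabla u^\varepsilon|^2}}\Big)=-\big(\varepsilon^2+|\nabla u^\varepsilon|^2\big)^{-\frac1{2k}}\ \text{in }\Omega,\qquad u^\varepsilon=0\ \text{on }\partial\Omega .$$ A function $u\in C^{0,1}(\overline\Omega)$ is a weak $H^k$-flow generated by $\Omega$ if there are $\varepsilon_i\to0$, $\varepsilon_i>0$, and smooth solutions $u^{\varepsilon_i}$ of $(\star\star)_{\varepsilon_i}$, uniformly bounded in $C^{0,1}(\overline\Omega)$, such that $u^{\varepsilon_i}\to u$ uniformly on $\overline\Omega$. *)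

(* Defs.v *)
From mathcomp Require Export all_boot all_order all_algebra.
From mathcomp Require Export all_classical all_reals all_analysis.

Set Implicit Arguments.
Unset Strict Implicit.
Unset Printing Implicit Defensive.

Export Order.TTheory GRing.Theory Num.Theory.
Export numFieldNormedType.Exports.

Local Open Scope classical_set_scope.
Local Open Scope ring_scope.

(* The library's norm on 'rV[R]_d is the sup norm; it induces the usual
   topology, but lengths below have to be Euclidean. *)
Definition dotv (R : realType) (d : nat) (v w : 'rV[R]_d) : R :=
  \sum_(i < d) v 0 i * w 0 i.

Definition enorm (R : realType) (d : nat) (v : 'rV[R]_d) : R :=
  Num.sqrt (dotv v v).

Definition boundary (T : topologicalType) (A : set T) : set T :=
  closure A `\` interior A.

Definition partial (R : realType) (d : nat) (i : 'I_d) (f : 'rV[R]_d -> R) :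
  'rV[R]_d -> R := fun x => 'D_(delta_mx 0 i) f x.

Definition partials (R : realType) (d : nat) (s : seq 'I_d)
  (f : 'rV[R]_d -> R) : 'rV[R]_d -> R := foldr (@partial R d) f s.

Definition grad (R : realType) (d : nat) (f : 'rV[R]_d -> R) (x : 'rV[R]_d) :
  'rV[R]_d := \row_(i < d) partial i f x.

Definition divergence (R : realType) (d : nat) (X : 'rV[R]_d -> 'rV[R]_d)
  (x : 'rV[R]_d) : R := \sum_(i < d) partial i (fun y => X y 0 i) x.

(* C^oo(U), for U open. Without the derivability clause a continuous iterated
   partial could merely be the default value of a limit that fails to exist. *)
Definition smooth_on (R : realType) (d : nat) (U : set 'rV[R]_d)
  (f : 'rV[R]_d -> R) : Prop :=
  forall (s : seq 'I_d) (x : 'rV[R]_d), U x ->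
    {for x, continuous (partials s f)} /\
    forall i : 'I_d, derivable (partials s f) x (delta_mx 0 i).

(* C^oo(closure U), for U open: every partial derivative on U has a continuous
   extension to the closure. The first clause makes f itself, and not only its
   restriction to U, continuous on the closure. *)
Definition smooth_closure (R : realType) (d : nat) (U : set 'rV[R]_d)
  (f : 'rV[R]_d -> R) : Prop :=
  [/\ {within closure U, continuous f},
      smooth_on U f
    & forall s : seq 'I_d, exists g : 'rV[R]_d -> R,
        {within closure U, continuous g} /\
        (forall x, U x -> g x = partials s f x)].

(* In W the set Omega is the sublevel {phi < 0}; since grad phi does not vanish,
   the boundary of Omega in W is then exactly {phi = 0}, and grad phi points
   out of Omega there. *)
Definition defining_function (R : realType) (d : nat) (Omega W : set 'rV[R]_d)
  (phi : 'rV[R]_d -> R) : Prop :=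
  [/\ open W, smooth_on W phi,
      forall x, W x -> grad phi x != 0
    & forall x, W x -> (Omega x <-> phi x < 0)].

Definition smooth_boundary (R : realType) (d : nat) (Omega : set 'rV[R]_d) :
  Prop :=
  forall p, boundary Omega p ->
    exists (W : set 'rV[R]_d) (phi : 'rV[R]_d -> R),
      W p /\ defining_function Omega W phi.

(* On the boundary this is the outer unit normal; off it, a smooth local
   extension of the latter. *)
Definition unit_normal (R : realType) (d : nat) (phi : 'rV[R]_d -> R)
  (x : 'rV[R]_d) : 'rV[R]_d := (enorm (grad phi x))^-1 *: grad phi x.

(* Trace of DX at p over the hyperplane orthogonal to the unit vector nu. It
   depends only on the values of X on a hypersurface through p with normal nu. *)
Definition tangential_divergence (R : realType) (d : nat) (nu : 'rV[R]_d)
  (X : 'rV[R]_d -> 'rV[R]_d) (p : 'rV[R]_d) : R :=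
  divergence X p - dotv ('D_nu X p) nu.

(* H is the trace of the Weingarten map v |-> D_v nu, not divided by the
   dimension: it is d.-1 on the unit sphere, and - H nu is the mean curvature
   vector. *)
Definition mean_curvature (R : realType) (d : nat) (phi : 'rV[R]_d -> R)
  (p : 'rV[R]_d) : R :=
  tangential_divergence (unit_normal phi p) (unit_normal phi) p.

(* The value at p does not depend on the defining function chosen there. *)
Definition positive_mean_curvature (R : realType) (d : nat)
  (Omega : set 'rV[R]_d) : Prop :=
  forall p, boundary Omega p ->
  forall (W : set 'rV[R]_d) (phi : 'rV[R]_d -> R),
    W p -> defining_function Omega W phi -> 0 < mean_curvature phi p.

Definition regularized_solution (R : realType) (d : nat) (k eps : R)
  (Omega : set 'rV[R]_d) (u : 'rV[R]_d -> R) : Prop :=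
  [/\ smooth_closure Omega u,
      forall x, Omega x ->
        divergence
          (fun y => (Num.sqrt (eps ^+ 2 + enorm (grad u y) ^+ 2))^-1
                      *: grad u y) x
        = - (eps ^+ 2 + enorm (grad u x) ^+ 2) `^ (- (2 * k)^-1)
    & forall x, boundary Omega x -> u x = 0].

Definition C01_bounded (R : realType) (d : nat) (A : set 'rV[R]_d) (C : R)
  (u : 'rV[R]_d -> R) : Prop :=
  (forall x, A x -> `|u x| <= C) /\
  (forall x y, A x -> A y -> `|u x - u y| <= C * enorm (x - y)).

(* Functions on the closure of Omega are represented by functions on the whole
   space, whose values outside the closure are irrelevant. *)
Definition weak_Hk_flow (R : realType) (d : nat) (k : R)
  (Omega : set 'rV[R]_d) (u : 'rV[R]_d -> R) : Prop :=
  (exists C : R, C01_bounded (closure Omega) C u) /\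
  exists (eps : nat -> R) (ue : nat -> 'rV[R]_d -> R),
    [/\ forall i, 0 < eps i,
        eps @ \oo --> (0 : R),
        forall i, regularized_solution k (eps i) Omega (ue i),
        exists C : R, forall i, C01_bounded (closure Omega) C (ue i)
      & {uniform closure Omega, ue @ \oo --> u}].

(* Main.v *)
Require Import Defs.
From mathcomp Require Import ring lra.

Local Open Scope classical_set_scope.
Local Open Scope ring_scope.

Set Implicit Arguments.
Unset Strict Implicit.
Unset Printing Implicit Defensive.

(* The proof is a comparison by doubling of variables, carried out on the smooth
   approximations themselves. For [lam < 1] let [(x, y)] maximize
   [lam * f x - g y - M |x - y|^(2m+4)], with [f], [g] the solutions for [eps] and
   [del <= lam * eps]. If [lam * f - g] is somewhere bounded below by [eta > 0],
   then for [M] large the Lipschitz bounds and the boundary values make [x] and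
   [y] interior points. There [lam * grad f x = grad g y = p], and the Hessians
   satisfy [lam D^2 f <= D^2 g], [lam D^2 f <= B], [D^2 g >= -B], where
   [B ~ |x - y|^(2m+2)]. The equation for [g] alone gives
   [|p|^(1-1/k) <= const * B], which bounds [|x - y|] below independently of
   [eps] and [del], because [2m+2 > k]. As [eps -> 0], the difference of the two
   equations becomes [|p|^(1-1/k) <= lam^(1/k) |p|^(1-1/k)], which is absurd. *)

(** * Directional derivatives and restriction to lines *)

Lemma is_derive_line (R : realType) (V : normedModType R) (f : V -> R)
    (x v : V) (t df : R) :
  is_derive (t *: v + x) v f df ->
  is_derive t 1 (fun s => f (s *: v + x)) df.
Proof.
move=> [fx <-].
have E : (fun h : R =>
      h^-1 *: ((f \o shift (t *: v + x)) (h *: v) - f (t *: v + x)))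
  = (fun h : R => h^-1 *: (((fun s => f (s *: v + x)) \o shift t) (h *: 1)
      - f (t *: v + x))).
  by apply/funext => h /=; rewrite [h *: 1]mulr1 scalerDl addrA.
by split; [move: fx; rewrite /derivable E | rewrite /derive E].
Qed.

Lemma is_derive_mull (R : realType) (c x : R) : is_derive x 1 ( *%R c) c.
Proof. by have := @is_deriveZ R R R id c x 1 1 _; rewrite [c *: 1]mulr1; exact. Qed.

(** The increment from [x] to [h *: (v + w) + x] is split at [h *: v + x]. The first leg gives [a];
    on the second the mean value theorem yields ['D_w f] at a nearby point, and continuity at [x]
    passes to the limit. Only directional differentiability enters, which is what [smooth_on]
    provides. *)
Lemma is_derive_dirD (R : realType) (V : normedModType R) (f : V -> R)
    (x v w : V) (a : R) :
  is_derive x v f a -> (\forall y \near x, derivable f y w) ->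
  {for x, continuous ('D_w f)} -> is_derive x (v + w) f (a + 'D_w f x).
Proof.
move=> [dv dva] dw cw.
suff H : (fun h : R => h^-1 *: ((f \o shift x) (h *: (v + w)) - f x)) @ 0^'
    --> a + 'D_w f x.
  by split; [apply/cvg_ex; exists (a + 'D_w f x) | exact/cvg_lim].
have -> : (fun h : R => h^-1 *: ((f \o shift x) (h *: (v + w)) - f x)) =
  (fun h : R => h^-1 *: ((f \o shift x) (h *: v) - f x)) +
  (fun h : R => h^-1 *: (f (h *: w + (h *: v + x)) - f (h *: v + x))).
  apply/funext => h; rewrite addrfctE -scalerDr /=; congr (_ *: _).
  by rewrite scalerDr [h *: v + h *: w]addrC -(addrA (h *: w)) [RHS]addrC subrKA.
apply: cvgD; first by rewrite -dva; exact: dv.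
apply/cvgrPdist_le => e e0.
have : \forall y \near x, derivable f y w /\ `|'D_w f x - 'D_w f y| <= e.
  near=> y; split; first by near: y.
  by near: y; move/cvgrPdist_le : cw; apply.
move=> /nbhs_ballP[d /= d0 xd].
near=> h.
have h0 : h != 0 by near: h; exact: nbhs_dnbhs_neq.
have dh (s : R) : 0 <= s <= 1 -> ball x d ((h * s) *: w + (h *: v + x)).
  move=> /andP[s0 s1]; rewrite -ball_normE /ball_ /=.
  have -> : x - ((h * s) *: w + (h *: v + x)) = - ((h * s) *: w + h *: v).
    by rewrite (addrA _ _ x) [_ + x]addrC opprD addNKr.
  rewrite normrN (le_lt_trans (ler_normD _ _))// !normrZ (ger0_norm s0).
  (* The summand 1 keeps the divisor positive when [v = w = 0]. *)
  have : `|h| * (1 + `|w| + `|v|) < d.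
    rewrite -ltr_pdivlMr; last by rewrite -addrA ltr_pwDl.
    near: h; apply: dnbhs0_lt; rewrite divr_gt0 // -addrA ltr_pwDl//.
  apply: le_lt_trans; rewrite -mulrA -mulrDr ler_wpM2l// lerD2r.
  by rewrite (le_trans (ler_piMl _ s1)) // ler_wpDl.
have dF (s : R) : 0 <= s <= 1 ->
    is_derive s 1 (fun s => f ((h * s) *: w + (h *: v + x)))
    (h * 'D_w f ((h * s) *: w + (h *: v + x))).
  move=> /dh/xd[+ _] => /derivableP/(@is_derive_line R V f (h *: v + x) w) D.
  have := @is_derive1_comp _ _ _ _ _ _ D (@is_derive_mull R h s).
  by rewrite mulrC.
have [||s s01 E] := @MVT_segment R
  (fun s => f ((h * s) *: w + (h *: v + x)))
  (fun s => h * 'D_w f ((h * s) *: w + (h *: v + x))) 0 1 ler01.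
- by move=> s; rewrite in_itv => /andP[s0 s1]; apply: dF; rewrite !ltW.
- apply: derivable_within_continuous => s; rewrite in_itv /= => s01.
  by case: (dF s s01).
move: E; rewrite subr0 !mulr1 mulr0 scale0r add0r => ->.
rewrite [h^-1 *: _]mulKf//.
by case: (xd _ (dh s _)).
Unshelve. all: by end_near. Qed.

Lemma is_derive_of_line (R : realType) (V : normedModType R) (f : V -> R)
    (x v : V) (df : R) :
  is_derive (0 : R) 1 (fun s : R => f (s *: v + x)) df -> is_derive x v f df.
Proof.
move=> [fx <-].
have E : (fun h : R => h^-1 *: ((f \o shift x) (h *: v) - f x))
  = (fun h : R => h^-1 *: (((fun s => f (s *: v + x)) \o shift (0 : R)) (h *: 1)
      - f (0 *: v + x))).
  by apply/funext => h /=; rewrite [h *: 1]mulr1 addr0 scale0r add0r.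
by split; [move: fx; rewrite /derivable -E | rewrite /derive -E].
Qed.

Lemma is_derive_scale (R : realType) (V : normedModType R) (f : V -> R)
    (x v : V) (c df : R) :
  is_derive x v f df -> is_derive x (c *: v) f (c * df).
Proof.
move=> D; apply: is_derive_of_line.
have D1 : is_derive (c * 0) 1 (fun s => f (s *: v + x)) df.
  by rewrite mulr0; apply: is_derive_line; rewrite scale0r add0r.
have := @is_derive1_comp _ _ _ _ _ _ D1 (@is_derive_mull R c 0); rewrite mulrC.
congr is_derive; apply/funext => s /=.
by rewrite scalerA mulrC.
Qed.

(** The direction is built up one coordinate at a time, each new term being added by
    [is_derive_dirD]. *)
Lemma is_derive_partials (R : realType) (d : nat) (f : 'rV[R]_d -> R)
    (x xi : 'rV[R]_d) :
  (\forall y \near x, forall i, derivable f y (delta_mx 0 i)) ->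
  (forall i, {for x, continuous (partial i f)}) ->
  is_derive x xi f (\sum_i xi 0 i * partial i f x).
Proof.
move=> df cf; rewrite [X in is_derive _ X](row_sum_delta xi).
elim: (index_enum 'I_d) => [|i r IH].
  by rewrite !big_nil; exact: is_derive0.
rewrite !big_cons addrC [X in is_derive _ _ _ X]addrC.
have D y : derivable f y (delta_mx 0 i) ->
    is_derive y (xi 0 i *: delta_mx 0 i) f (xi 0 i * partial i f y).
  by move=> dfy; apply: is_derive_scale; split.
have DE y : derivable f y (delta_mx 0 i) ->
    'D_(xi 0 i *: delta_mx 0 i) f y = xi 0 i * partial i f y.
  by move=> /D ?; rewrite derive_val.
have dx : derivable f x (delta_mx 0 i) by have /(_ i) := nbhs_singleton df.
have Dnear : \forall y \near x, derivable f y (xi 0 i *: delta_mx 0 i).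
  near=> y; have [|//] := D y _.
  by move: i {IH D DE dx}; near: y.
have C : {for x, continuous ('D_(xi 0 i *: delta_mx 0 i) f)}.
  have : xi 0 i * partial i f y @[y --> x] --> xi 0 i * partial i f x.
    exact: (cvgM (cvg_cst (xi 0 i)) (cf i)).
  have E : \forall y \near x,
      xi 0 i * partial i f y = 'D_(xi 0 i *: delta_mx 0 i) f y.
    near=> y; apply/esym/DE.
    by move: i {IH D DE dx Dnear}; near: y.
  by rewrite -(DE _ dx); apply: cvg_trans; exact: near_eq_cvg E.
have := @is_derive_dirD R _ f _ _ _ _ IH Dnear C.
by rewrite (DE _ dx).
Unshelve. all: by end_near. Qed.

(** If [c > 0], then [h] is positive just to the right of 0, so by the mean value theorem [g]
    exceeds [g 0] there. *)
Lemma second_derivative_test (R : realType) (g h : R -> R) (c : R) :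
  (\forall t \near (0 : R), is_derive (t : R) 1 g (h t)) ->
  is_derive (0 : R) 1 h c ->
  (\forall t \near (0 : R), g t <= g 0) -> h 0 = 0 /\ c <= 0.
Proof.
move=> dg dh mg.
have [e e0 H] : exists2 e : R, 0 < e & forall t, `|t| < e ->
    is_derive (t : R) 1 g (h t) /\ g t <= g 0.
  have : \forall t \near (0 : R), is_derive (t : R) 1 g (h t) /\ g t <= g 0.
    by near=> t; split; near: t.
  move=> /nbhs_ballP[e /= e0 eH]; exists e => // t te; apply: eH.
  by rewrite -ball_normE /ball_ /= sub0r normrN.
have h0 : h 0 = 0.
  have [|t|||_ Dg0] := @derive1_at_max R g (- e) e 0.
  - by rewrite ge0_cp // ltW.
  - by rewrite in_itv /= -ltr_norml => /H[[]].
  - by rewrite in_itv /= e0 oppr_lt0 e0.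
  - by move=> t; rewrite in_itv /= -ltr_norml => /H[].
  - by have [[_ Dgh] _] := H 0 ltac:(by rewrite normr0); rewrite -Dgh.
split => //; rewrite leNgt; apply/negP => c0.
case: dh => + E; rewrite /derivable => dh.
have hc :
    (fun t : R => t^-1 *: ((h \o shift (0 : R)) (t *: 1) - h 0)) @ 0^' --> c.
  by rewrite -E.
have : \forall t \near 0^', 0 < t^-1 *: ((h \o shift (0 : R)) (t *: 1) - h 0).
  by apply: (cvgr_gt c).
rewrite near_withinE => /nbhs_ballP[e1 /= e10 H1].
have hpos t : 0 < t < e1 -> 0 < h t.
  move=> /andP[t0 te]; have /H1/(_ (lt0r_neq0 t0)) : ball 0 e1 t.
    by rewrite -ball_normE /ball_ /= sub0r normrN gtr0_norm.
  by rewrite /= addr0 h0 subr0 [t *: 1]mulr1 [_ *: _]mulrC pmulr_lgt0 ?invr_gt0.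
pose s := Num.min e e1 / 2.
have m0 : 0 < Num.min e e1 by rewrite lt_min e0.
have s0 : 0 < s by rewrite divr_gt0.
have sm : s < Num.min e e1 by rewrite ltr_pdivrMr // ltr_pMr // ltr1n.
have [se se1] : s < e /\ s < e1 by move: sm; rewrite lt_min => /andP.
have [||t ts] := @MVT R g h 0 s s0.
- move=> t; rewrite in_itv /= => /andP[t0 ts].
  by case: (H t) => //; rewrite gtr0_norm // (lt_trans ts).
- apply: derivable_within_continuous => t; rewrite in_itv /= => /andP[t0 ts].
  by case: (H t) => [|[]] //; rewrite ger0_norm // (le_lt_trans ts).
have [_ gs] := H s ltac:(by rewrite gtr0_norm).
move=> E1; have : g s - g 0 <= 0 by rewrite subr_le0.
rewrite E1 subr0 leNgt => /negP; apply; apply: mulr_gt0 => //.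
apply: hpos; move: ts; rewrite in_itv /= => /andP[-> /=] /lt_trans; exact.
Unshelve. all: by end_near. Qed.

(** * Euclidean products, quadratic forms and traces *)

Definition qform (R : realType) (d : nat) (H : 'M[R]_d) (v : 'rV[R]_d) : R :=
  (v *m H *m v^T) 0 0.

Definition hessian (R : realType) (d : nat) (f : 'rV[R]_d -> R)
    (x : 'rV[R]_d) : 'M[R]_d := \matrix_(i, j) partial i (partial j f) x.

Lemma dotvE (R : realType) (d : nat) (v w : 'rV[R]_d) :
  dotv v w = (v *m w^T) 0 0.
Proof. by rewrite mxE; apply: eq_bigr => i _; rewrite mxE. Qed.

Lemma dotv_ge0 (R : realType) (d : nat) (v : 'rV[R]_d) : 0 <= dotv v v.
Proof. by apply: sumr_ge0 => i _; rewrite -expr2 sqr_ge0. Qed.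

Lemma dotv_eq0 (R : realType) (d : nat) (v : 'rV[R]_d) : dotv v v = 0 -> v = 0.
Proof.
move=> /psumr_eq0P v0; apply/rowP => i; rewrite mxE.
have := v0 (fun i _ => ltac:(by rewrite -expr2 sqr_ge0)) i isT.
by move/eqP; rewrite mulf_eq0 orbb => /eqP.
Qed.

Lemma dotvC (R : realType) (d : nat) (v w : 'rV[R]_d) : dotv v w = dotv w v.
Proof. by apply: eq_bigr => i _; rewrite mulrC. Qed.

Lemma dotvDl (R : realType) (d : nat) (u v w : 'rV[R]_d) :
  dotv (u + v) w = dotv u w + dotv v w.
Proof. by rewrite !dotvE mulmxDl mxE. Qed.

Lemma dotvZl (R : realType) (d : nat) (a : R) (v w : 'rV[R]_d) :
  dotv (a *: v) w = a * dotv v w.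
Proof. by rewrite !dotvE -scalemxAl mxE. Qed.

Lemma dotvDr (R : realType) (d : nat) (u v w : 'rV[R]_d) :
  dotv u (v + w) = dotv u v + dotv u w.
Proof. by rewrite dotvC dotvDl !(dotvC u). Qed.

Lemma dotvZr (R : realType) (d : nat) (a : R) (v w : 'rV[R]_d) :
  dotv v (a *: w) = a * dotv v w.
Proof. by rewrite dotvC dotvZl dotvC. Qed.

Lemma dotv_deltal (R : realType) (d : nat) (i : 'I_d) (v : 'rV[R]_d) :
  dotv (delta_mx 0 i) v = v 0 i.
Proof. by rewrite dotvE -rowE !mxE. Qed.

Lemma dotv_CauchySchwarz (R : realType) (d : nat) (v w : 'rV[R]_d) :
  dotv v w ^+ 2 <= dotv v v * dotv w w.
Proof.
have [v0|v0] := eqVneq (dotv v v) 0.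
  by rewrite (dotv_eq0 v0) -(scale0r 0) dotvZl mul0r expr0n /= dotvZl !mul0r.
have vp : 0 < dotv v v by rewrite lt_neqAle eq_sym v0 dotv_ge0.
(* The squared length of this vector is [dotv v v] times the gap in the inequality. *)
have := dotv_ge0 (dotv v v *: w + (- dotv v w) *: v).
rewrite !(dotvDl, dotvDr, dotvZl, dotvZr) (dotvC w v) => H.
by rewrite -subr_ge0 -(pmulr_rge0 _ vp); move: H; congr (0 <= _); ring.
Qed.

Lemma enorm_sqr (R : realType) (d : nat) (v : 'rV[R]_d) :
  enorm v ^+ 2 = dotv v v.
Proof. by rewrite sqr_sqrtr // dotv_ge0. Qed.

Lemma qformD (R : realType) (d : nat) (A B : 'M[R]_d) (v : 'rV[R]_d) :
  qform (A + B) v = qform A v + qform B v.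
Proof. by rewrite /qform mulmxDr mulmxDl mxE. Qed.

Lemma qformZ (R : realType) (d : nat) (a : R) (A : 'M[R]_d) (v : 'rV[R]_d) :
  qform (a *: A) v = a * qform A v.
Proof. by rewrite /qform -scalemxAr -scalemxAl mxE. Qed.

Lemma qform_scale (R : realType) (d : nat) (a : R) (A : 'M[R]_d) (v : 'rV[R]_d) :
  qform A (a *: v) = a ^+ 2 * qform A v.
Proof. by rewrite /qform linearZ /= -scalemxAr -!scalemxAl !mxE mulrA. Qed.

Lemma qform1 (R : realType) (d : nat) (v : 'rV[R]_d) : qform 1%:M v = dotv v v.
Proof. by rewrite /qform mulmx1 dotvE. Qed.

Lemma qformE (R : realType) (d : nat) (H : 'M[R]_d) (v : 'rV[R]_d) :
  qform H v = \sum_i \sum_j v 0 i * v 0 j * H i j.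
Proof.
rewrite /qform -mulmxA mxE; apply: eq_bigr => i _.
rewrite mxE big_distrr /=; apply: eq_bigr => j _; rewrite !mxE.
by rewrite [H i j * _]mulrC mulrA.
Qed.

(** Each diagonal entry of [N *m H *m N^T] is [qform H] at a row of [N]. *)
Lemma mxtrace_congr_ge0 (R : realType) (d : nat) (N H : 'M[R]_d) :
  (forall v, 0 <= qform H v) -> 0 <= \tr (N *m H *m N^T).
Proof.
move=> H0; apply: sumr_ge0 => i _.
rewrite (le_trans (H0 (row i N))) // /qform -row_mul !mxE le_eqVlt.
by apply/orP; left; apply/eqP; apply: eq_bigr => j _; rewrite !mxE.
Qed.

(* The projection [N = 1 - p^T p / |p|^2] onto the orthogonal of [p] turns
   [tr H - qform H p / |p|^2] into [tr (N H N^T)]. *)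
Lemma qform_div_le_mxtrace (R : realType) (d : nat) (H : 'M[R]_d)
    (p : 'rV[R]_d) (w : R) :
  (forall v, 0 <= qform H v) -> dotv p p <= w -> qform H p / w <= \tr H.
Proof.
move=> H0 pw.
have [p0|p0] := eqVneq (dotv p p) 0.
  rewrite (dotv_eq0 p0) /qform !mul0mx mxE mul0r.
  by have := mxtrace_congr_ge0 1%:M H0; rewrite trmx1 mulmx1 mul1mx.
have pp : 0 < dotv p p by rewrite lt_neqAle eq_sym p0 dotv_ge0.
apply: (@le_trans _ _ (qform H p / dotv p p)).
  by rewrite ler_wpM2l // lef_pV2 // ?posrE // (lt_le_trans pp).
pose N : 'M[R]_d := 1%:M - (dotv p p)^-1 *: (p^T *m p).
have NT : N^T = N by rewrite /N linearB linearZ /= trmx1 trmx_mul trmxK.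
have ppE : p *m p^T = (dotv p p)%:M by rewrite dotvE -mx11_scalar.
have NN : N *m N = N.
  rewrite /N mulmxBr mulmx1 mulmxBl mul1mx -!scalemxAl -!scalemxAr.
  rewrite -mulmxA (mulmxA p) ppE mul_scalar_mx -!scalemxAr !scalerA.
  by rewrite mulVf // mulr1 subrr subr0.
have := mxtrace_congr_ge0 N H0.
rewrite NT mxtrace_mulC mulmxA NN /N mulmxBl mul1mx linearB /= -scalemxAl.
rewrite linearZ /= subr_ge0 -mulmxA mxtrace_mulC /qform.
by rewrite [X in \tr X]mx11_scalar mxtrace_scalar mulrC.
Qed.

(** * The regularized operator in terms of gradient and Hessian *)

Lemma is_derive_comp (R : realType) (V : normedModType R) (f : V -> R)
    (phi : R -> R) (x v : V) (a b : R) :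
  is_derive x v f a -> is_derive (f x) 1 phi b ->
  is_derive x v (phi \o f) (b * a).
Proof.
move=> Df Dphi; apply: is_derive_of_line.
have D1 : is_derive (0 : R) 1 (fun s => f (s *: v + x)) a.
  by apply: is_derive_line; rewrite scale0r add0r.
have D2 : is_derive (f ((0 : R) *: v + x)) 1 phi b by rewrite scale0r add0r.
exact: is_derive1_comp D2 D1.
Qed.

Lemma is_derive_sqrtV (R : realType) (t : R) : 0 < t ->
  is_derive t 1 (fun s => (Num.sqrt s)^-1) (- (2 * t * Num.sqrt t)^-1).
Proof.
move=> t0; have D := is_derive1_sqrt t0.
have s0 : 0 < Num.sqrt t by rewrite sqrtr_gt0.
have := is_deriveV (lt0r_neq0 s0) D.
congr is_derive; rewrite [_ *: _]mulrC mulrN sqr_sqrtr ?ltW//.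
by rewrite -invfM; congr (- _^-1); ring.
Qed.

Lemma near_line (R : realType) (V : normedModType R) (U : set V) (x v : V) :
  open U -> U x -> \forall t \near (0 : R), U (t *: v + x).
Proof.
move=> oU Ux.
have c : (fun t : R => t *: v + x) @ (0 : R) --> x.
  rewrite -[X in _ --> X]add0r -[X in _ --> X + _](scale0r v).
  by apply: cvgD; [apply: cvgZr_tmp|exact: cvg_cst].
by apply: c; exact: open_nbhs_nbhs.
Qed.

Lemma smooth_on_is_derive (R : realType) (d : nat) (U : set 'rV[R]_d)
    (f : 'rV[R]_d -> R) (s : seq 'I_d) (x xi : 'rV[R]_d) :
  open U -> smooth_on U f -> U x ->
  is_derive x xi (partials s f) (\sum_i xi 0 i * partials (i :: s) f x).
Proof.
move=> oU sf Ux; apply: is_derive_partials.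
  have : nbhs x U by exact: open_nbhs_nbhs.
  by apply: filterS => y Uy; case: (sf s y Uy).
by move=> i; case: (sf (i :: s) x Ux).
Qed.

Lemma smooth_on_is_derive_line (R : realType) (d : nat) (U : set 'rV[R]_d)
    (f : 'rV[R]_d -> R) (x xi : 'rV[R]_d) (t : R) :
  open U -> smooth_on U f -> U (t *: xi + x) ->
  is_derive t 1 (fun s => f (s *: xi + x)) (dotv xi (grad f (t *: xi + x))).
Proof.
move=> oU sf Ux; apply: is_derive_line.
have -> : dotv xi (grad f (t *: xi + x)) =
    \sum_i xi 0 i * partials [:: i] f (t *: xi + x).
  by apply: eq_bigr => i _; rewrite mxE.
exact: (@smooth_on_is_derive R d U f [::] _ xi oU sf Ux).
Qed.

Lemma smooth_on_is_derive2_line (R : realType) (d : nat) (U : set 'rV[R]_d)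
    (f : 'rV[R]_d -> R) (x xi : 'rV[R]_d) :
  open U -> smooth_on U f -> U x ->
  is_derive (0 : R) 1 (fun t => dotv xi (grad f (t *: xi + x)))
    (qform (hessian f x) xi).
Proof.
move=> oU sf Ux.
have -> : (fun t : R => dotv xi (grad f (t *: xi + x))) =
    \sum_(j < d) (xi 0 j \*: (fun t : R => partial j f (t *: xi + x))).
  by apply/funext => t; rewrite fct_sumE; apply: eq_bigr => j _; rewrite mxE.
have -> : qform (hessian f x) xi =
    \sum_j xi 0 j *: \sum_i xi 0 i * partials [:: i; j] f x.
  rewrite qformE exchange_big /=; apply: eq_bigr => j _.
  rewrite [_ *: _]big_distrr /=; apply: eq_bigr => i _.
  by rewrite mxE mulrA [xi 0 j * _]mulrC.
apply: is_derive_sum => j; apply: is_deriveZ; apply: is_derive_line.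
by rewrite scale0r add0r; exact: (@smooth_on_is_derive R d U f [:: j] x xi oU sf Ux).
Qed.

(** Since [eps > 0], the radicand stays positive and the quotient can be differentiated even at
    critical points of [f]. The resulting nondivergence form is the one into which Hessian
    inequalities can be inserted. *)
Lemma divergence_normalized_grad (R : realType) (d : nat) (U : set 'rV[R]_d)
    (f : 'rV[R]_d -> R) (eps : R) (x : 'rV[R]_d) :
  0 < eps -> smooth_on U f -> U x ->
  divergence (fun y => (Num.sqrt (eps ^+ 2 + enorm (grad f y) ^+ 2))^-1
                         *: grad f y) x =
  (Num.sqrt (eps ^+ 2 + dotv (grad f x) (grad f x)))^-1 *
  (\tr (hessian f x) - qform (hessian f x) (grad f x) /
     (eps ^+ 2 + dotv (grad f x) (grad f x))).
Proof.
move=> e0 sf Ux.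
pose W y := eps ^+ 2 + dotv (grad f y) (grad f y).
have W0 y : 0 < W y by rewrite ltr_pwDl ?exprn_gt0 // dotv_ge0.
have Dp i j : is_derive x (delta_mx 0 i) (partial j f) (hessian f x i j).
  by rewrite mxE; apply: derivableP; case: (sf [:: j] x Ux) => _; exact.
have WE : W = cst (eps ^+ 2) + \sum_j (partial j f) ^+ 2.
  apply/funext => y; rewrite /W /dotv addrfctE fct_sumE; congr (_ + _).
  by apply: eq_bigr => j _; rewrite !mxE expr2.
have DW i : is_derive x (delta_mx 0 i) W
    (2 * \sum_j grad f x 0 j * hessian f x i j).
  rewrite WE; apply: is_derive_eq; rewrite add0r big_distrr /=.
  by apply: eq_bigr => j _; rewrite !mxE expr1 [RHS]mulrA.
have DF i : is_derive x (delta_mx 0 i)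
    (((fun t => (Num.sqrt t)^-1) \o W) * partial i f)
    ((Num.sqrt (W x))^-1 * hessian f x i i -
     (W x * Num.sqrt (W x))^-1 *
     \sum_j grad f x 0 i * grad f x 0 j * hessian f x i j).
  have D1 := is_derive_comp (DW i) (is_derive_sqrtV (W0 x)).
  apply: (is_derive_eq (is_deriveM D1 (Dp i i))).
  congr (_ + _); rewrite [_ *: _]mulrA.
  transitivity (- (W x * Num.sqrt (W x))^-1 *
      (grad f x 0 i * \sum_j grad f x 0 j * hessian f x i j)).
    rewrite !mxE !mulrA; congr (_ * _).
    have w0 := lt0r_neq0 (W0 x).
    have s0 : Num.sqrt (W x) != 0 by rewrite lt0r_neq0 // sqrtr_gt0.
    by rewrite !invfM; field; rewrite w0 s0.
  rewrite mulNr big_distrr /=; congr (- (_ * _)).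
  by apply: eq_bigr => j _; rewrite /= mulrA.
rewrite /divergence.
transitivity (\sum_i ((Num.sqrt (W x))^-1 * hessian f x i i -
     (W x * Num.sqrt (W x))^-1 *
     \sum_j grad f x 0 i * grad f x 0 j * hessian f x i j)).
  apply: eq_bigr => i _; rewrite -(@derive_val _ _ _ _ _ _ _ (DF i)) /partial.
  have -> : (fun y => ((Num.sqrt (eps ^+ 2 + enorm (grad f y) ^+ 2))^-1
      *: grad f y) 0 i) = ((fun t => (Num.sqrt t)^-1) \o W) * partial i f.
    by apply/funext => y; rewrite mulrfctE /W !mxE /= enorm_sqr.
  by [].
rewrite sumrB -!big_distrr /= -qformE mulrBr; congr (_ - _).
by rewrite invfM; ring.
Qed.

(** * The penalty and the conditions at a maximum of the doubled functional *)

(** This is [M |z|^(2m+4)]. The even power makes it a polynomial along every line, so its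
    derivatives there are formal ones, also at [z = 0]. *)
Definition penalty (R : realType) (d : nat) (M : R) (m : nat)
  (z : 'rV[R]_d) : R := M * dotv z z ^+ m.+2.

(* [grad (penalty M m) z = slope M m (dotv z z) *: z] *)
Definition slope (R : realType) (M : R) (m : nat) (a : R) : R :=
  2 * M * m.+2%:R * a ^+ m.+1.

Lemma slope_ge0 (R : realType) (M : R) (m : nat) (a : R) :
  0 <= M -> 0 <= a -> 0 <= slope M m a.
Proof. by move=> M0 a0; rewrite !mulr_ge0 ?exprn_ge0. Qed.

Lemma slope_gt0 (R : realType) (M : R) (m : nat) (a : R) :
  0 < M -> 0 < a -> 0 < slope M m a.
Proof. by move=> M0 a0; rewrite /slope mulr_gt0 ?exprn_gt0 // !mulr_gt0. Qed.

Lemma is_derive_horner (R : realType) (p : {poly R}) (t : R) :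
  is_derive t 1 (horner p) (p^`()).[t].
Proof.
by split; [exact: derivable_horner|rewrite -derive1E derivE].
Qed.

Lemma penalty_line (R : realType) (d : nat) (M : R) (m : nat)
    (z eta : 'rV[R]_d) (t : R) :
  penalty M m (t *: eta + z) =
  (M *: ((dotv z z)%:P + (2 * dotv eta z) *: 'X + dotv eta eta *: 'X^2)
        ^+ m.+2).[t].
Proof.
rewrite /penalty !(dotvDl, dotvDr, dotvZl, dotvZr) (dotvC z eta).
rewrite hornerZ horner_exp !(hornerD, hornerZ, hornerC, hornerX, hornerXn).
by congr (_ * _ ^+ _); ring.
Qed.

Lemma penalty_poly_derivs (R : realType) (M : R) (m : nat) (a b c : R) :
  let p := M *: (a%:P + (2 * b) *: 'X + c *: 'X^2) ^+ m.+2 in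
  (p^`()).[0] = slope M m a * b /\
  (p^`()^`()).[0] = slope M m a * c +
    M * m.+2%:R * m.+1%:R * 4 * a ^+ m * b ^+ 2.
Proof.
set q := _ + _ + _ => p.
have q0 : q.[0] = a.
  by rewrite /q !(hornerD, hornerZ, hornerC, hornerX, hornerXn); ring.
have q1E : q^`() = (2 * b)%:P + (2 * c) *: 'X.
  rewrite /q !(derivD, derivC, derivZ, derivX, derivXn) add0r expr1 alg_polyC.
  by rewrite -scalerMnr scalerMnl !mulr_natl.
have q1 : (q^`()).[0] = 2 * b.
  by rewrite q1E !(hornerD, hornerZ, hornerC, hornerX); ring.
have q2 : (q^`()^`()).[0] = 2 * c.
  by rewrite q1E !(derivD, derivC, derivZ, derivX) add0r alg_polyC hornerC.
clearbody q; rewrite {}/p derivZ deriv_exp !derivZ derivMn derivM deriv_exp.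
rewrite !(hornerZ, hornerMn, hornerM, hornerD, horner_exp) q0 q1 q2 /= /slope.
rewrite -[(_ * _) *+ m.+2]mulr_natr -[(_ * _) *+ m.+1]mulr_natr.
rewrite -[(_ + _) *+ m.+2]mulr_natr exprS.
by split; ring.
Qed.

(** The functional is restricted to the line [(x + t xi, y + t zeta)] and the one-variable test
    applied at [t = 0]. In the second derivative of the penalty, Cauchy-Schwarz bounds [b ^+ 2] by
    [c * a]; this adds [2(m+1)] slopes to the one already there, whence the factor [2m+3]. *)
Lemma doubling_max (R : realType) (d : nat) (U : set 'rV[R]_d)
    (f g : 'rV[R]_d -> R) (lam M : R) (m : nat) (x y : 'rV[R]_d) :
  open U -> smooth_on U f -> smooth_on U g -> U x -> U y -> 0 <= M ->
  (forall x' y', U x' -> U y' ->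
    lam * f x' - g y' - penalty M m (x' - y') <=
    lam * f x - g y - penalty M m (x - y)) ->
  forall xi zeta : 'rV[R]_d,
  lam * dotv xi (grad f x) - dotv zeta (grad g y) =
    slope M m (dotv (x - y) (x - y)) * dotv (xi - zeta) (x - y) /\
  lam * qform (hessian f x) xi - qform (hessian g y) zeta <=
    m.*2.+3%:R * slope M m (dotv (x - y) (x - y)) * dotv (xi - zeta) (xi - zeta).
Proof.
move=> oU sf sg Ux Uy M0 xymax xi zeta.
set z := x - y; set eta := xi - zeta.
set a := dotv z z; set b := dotv eta z; set c := dotv eta eta.
pose q : {poly R} := a%:P + (2 * b) *: 'X + c *: 'X^2.
pose p := M *: q ^+ m.+2.
have pE t : penalty M m ((t *: xi + x) - (t *: zeta + y)) = p.[t].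
  have -> : t *: xi + x - (t *: zeta + y) = t *: eta + z.
    by rewrite /eta /z scalerBr opprD addrACA.
  exact: penalty_line.
pose F t := lam * f (t *: xi + x) - g (t *: zeta + y) - p.[t].
pose h t := lam * dotv xi (grad f (t *: xi + x)) -
   dotv zeta (grad g (t *: zeta + y)) - (p^`()).[t].
have dF : \forall t \near (0 : R), is_derive (t : R) 1 F (h t).
  near=> t.
  have Ut : U (t *: xi + x) by near: t; exact: near_line.
  have Vt : U (t *: zeta + y) by near: t; exact: near_line.
  have D1 := is_deriveZ lam (smooth_on_is_derive_line oU sf Ut).
  have D2 := smooth_on_is_derive_line oU sg Vt.
  exact: is_deriveB (is_deriveB D1 D2) (is_derive_horner p t).
have dh : is_derive (0 : R) 1 h (lam * qform (hessian f x) xi -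
    qform (hessian g y) zeta - (p^`()^`()).[0]).
  have D1 := is_deriveZ lam (smooth_on_is_derive2_line xi oU sf Ux).
  have D2 := smooth_on_is_derive2_line zeta oU sg Uy.
  exact: is_deriveB (is_deriveB D1 D2) (is_derive_horner p^`() 0).
have mF : \forall t \near (0 : R), F t <= F 0.
  near=> t; rewrite /F -!pE !scale0r !add0r.
  by apply: xymax; near: t; exact: near_line.
have [h0 h1] := second_derivative_test dF dh mF.
have [p1 p2] : _ /\ _ := penalty_poly_derivs M m a b c.
split.
  by move: h0; rewrite /h !scale0r !add0r /p /q p1 => /eqP; rewrite subr_eq0 => /eqP.
move: h1; rewrite /p /q p2 subr_le0 => /le_trans; apply.
have -> : m.*2.+3%:R * slope M m a * c =
    slope M m a * c + M * m.+2%:R * m.+1%:R * 4 * a ^+ m * (c * a).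
  rewrite /slope -muln2 -addn3 natrD natrM -(addn2 m) -(addn1 m) !natrD exprD.
  by rewrite expr1; ring.
rewrite lerD2l ler_wpM2l ?dotv_CauchySchwarz //.
by rewrite !mulr_ge0 // exprn_ge0 // dotv_ge0.
Unshelve. all: by end_near. Qed.

(** * The equation at an interior point and two scalar estimates *)

Lemma regularized_equation (R : realType) (d : nat) (k eps : R)
    (Omega : set 'rV[R]_d) (u : 'rV[R]_d -> R) (x : 'rV[R]_d) :
  0 < eps -> regularized_solution k eps Omega u -> Omega x ->
  let W := eps ^+ 2 + dotv (grad u x) (grad u x) in
  \tr (hessian u x) - qform (hessian u x) (grad u x) / W =
  - W `^ (2^-1 - (2 * k)^-1).
Proof.
move=> e0 [[_ su _] eqn _] Ox W.
have W0 : 0 < W by rewrite ltr_pwDl ?exprn_gt0 // dotv_ge0.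
have s0 : 0 < Num.sqrt W by rewrite sqrtr_gt0.
have := eqn x Ox; rewrite (divergence_normalized_grad e0 su Ox) enorm_sqr -/W.
move=> /(congr1 (fun t => Num.sqrt W * t)); rewrite mulVKf ?lt0r_neq0 // => ->.
rewrite mulrN powRD; last by rewrite lt0r_neq0 // implybT.
by rewrite powR12_sqrt // ltW.
Qed.

(** Put [s = sqrt a] and [kap = slope M m a]. Since twice the exponent is [1 - 1/k], the hypotheses
    give [(kap s)^(1-1/k) <= c kap], and the [k]-th power gives [s^(k-1) <= c^k kap = K s^(2m+2)].
    For [s < 1], [k - 1 <= m] turns this into [1 <= K s^(m+2) <= K s]. The bound does not involve
    [w], hence neither regularization parameter. *)
Lemma slope_lower_bound (R : realType) (k M c : R) (m : nat) :
  1 <= k -> k <= m%:R -> 0 < M -> 0 < c ->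
  exists2 a0 : R, 0 < a0 & forall a w : R, 0 <= a -> 0 < w ->
    slope M m a ^+ 2 * a <= w ->
    w `^ (2^-1 - (2 * k)^-1) <= c * slope M m a -> a0 <= a.
Proof.
move=> k1 km M0 c0.
have k0 : 0 < k by rewrite (lt_le_trans ltr01).
set q := 2^-1 - (2 * k)^-1.
have kV : k^-1 <= 1 by rewrite invf_le1.
have qE : 2%:R * q = 1 - k^-1 by rewrite /q; field; rewrite lt0r_neq0.
have q0 : 0 <= q by rewrite -(pmulr_rge0 _ (ltr0Sn R 1)) qE subr_ge0.
pose K := c `^ k * (2 * M * m.+2%:R).
have K0 : 0 < K by rewrite !mulr_gt0 // powR_gt0.
have r0 : 0 < Num.min 1 K^-1 by rewrite lt_min ltr01 invr_gt0.
exists (Num.min 1 K^-1 ^+ 2) => [|a w a0 w0 aw wk]; first by rewrite exprn_gt0.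
have slope0 : 0 < slope M m a.
  by rewrite -(pmulr_rgt0 _ c0) (lt_le_trans _ wk) // powR_gt0.
have ap : 0 < a.
  rewrite lt_neqAle a0 andbT eq_sym; apply/eqP => a00.
  by move: slope0; rewrite /slope a00 expr0n /= mulr0 ltxx.
pose s := Num.sqrt a.
have s0 : 0 < s by rewrite sqrtr_gt0.
have aE : a = s ^+ 2 by rewrite sqr_sqrtr.
rewrite [leRHS]aE ler_sqr ?nnegrE; [|exact: ltW r0|exact: ltW s0].
rewrite ge_min.
have [s1|//] /= := ltP s 1.
set kap := slope M m a in aw wk slope0.
have [s0' kap0 c0' k0'] : [/\ 0 <= s, 0 <= kap, 0 <= c & 0 <= k].
  by split; exact: ltW.
have w0' := ltW w0.
have sk0 : 0 <= kap * s by exact: mulr_ge0.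
have H1 : (kap * s) `^ (1 - k^-1) <= c * kap.
  rewrite -qE powRrM powR_mulrn; last by rewrite mulr_ge0 // ltW.
  by apply: le_trans wk; apply: ge0_ler_powR; rewrite ?nnegrE ?exprn_ge0 // exprMn -aE.
have H2 : (kap * s) `^ (k - 1) <= c `^ k * kap `^ k.
  have -> : k - 1 = (1 - k^-1) * k by rewrite mulrBl mul1r mulVf ?lt0r_neq0.
  rewrite powRrM -powRM //.
  by apply: ge0_ler_powR; rewrite ?nnegrE ?powR_ge0 // mulr_ge0.
have kapk : kap `^ k = kap * kap `^ (k - 1).
  rewrite -[X in X * _](powRr1 (kap0)) -powRD ?subrKC //.
  by rewrite lt0r_neq0 // implybT.
have H3 : s `^ (k - 1) <= c `^ k * kap.
  have := H2; rewrite kapk powRM // mulrA [X in X <= _]mulrC.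
  by rewrite ler_pM2r // powR_gt0.
have H4 : s ^+ m <= K * s ^+ m.+2 * s ^+ m.
  have : s ^+ m <= c `^ k * kap.
    apply: le_trans H3; rewrite -powR_mulrn //.
    by apply: ger_powR; [rewrite s0 ltW|rewrite lerBlDr (le_trans km) // lerDl].
  move/le_trans; apply; rewrite le_eqVlt; apply/orP; left; apply/eqP.
  rewrite /kap /slope /K aE -exprM -[RHS]mulrA -exprD [LHS]mulrA.
  by congr (_ * _ ^+ _); rewrite mul2n -addnn !addSn !addnS.
have H5 : 1 <= K * s ^+ m.+2.
  by rewrite -(ler_pM2r (exprn_gt0 m s0)) mul1r.
rewrite -[K^-1]mulr1 -ler_pdivlMl ?invr_gt0 // invrK.
apply: le_trans H5 _; rewrite ler_pM2l // exprS ler_piMr //.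
by rewrite exprn_ile1 // ltW.
Qed.

(** At [e = 0] the left side is [lam^(1/k) P^q] with [q = 1/2 - 1/(2k)], strictly below [P^q]. The
    lower bound [P0] makes this gap absorb the error uniformly in [P]. *)
Lemma perturbed_power_lt (R : realType) (k lam P0 K : R) :
  1 <= k -> 0 < lam < 1 -> 0 < P0 -> 0 <= K ->
  exists2 e0 : R, 0 < e0 & forall e P : R, 0 < e <= e0 -> P0 <= P ->
    lam * ((e + P) / lam ^+ 2) `^ (2^-1 - (2 * k)^-1) + e * K <
    P `^ (2^-1 - (2 * k)^-1).
Proof.
move=> k1 /andP[lam0 lam1] P00 K0.
have k0 : 0 < k by rewrite (lt_le_trans ltr01).
set q := 2^-1 - (2 * k)^-1.
have kV : k^-1 <= 1 by rewrite invf_le1.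
have qE : 2%:R * q = 1 - k^-1 by rewrite /q; field; rewrite lt0r_neq0.
have q0 : 0 <= q by rewrite -(pmulr_rge0 _ (ltr0Sn R 1)) qE subr_ge0.
have q1 : q <= 1.
  have kV0 : 0 < k^-1 by rewrite invr_gt0.
  lra.
clearbody q.
have [lam0' k0' P00'] : [/\ 0 <= lam, 0 <= k^-1 & 0 <= P0].
  by split; rewrite ?invr_ge0; exact: ltW.
pose mu := lam `^ (k^-1).
have mu1 : mu < 1.
  suff : mu < 1 `^ k^-1 by rewrite powR1.
  by apply: gt0_ltr_powR; rewrite ?invr_gt0 ?nnegrE.
have mu0 : 0 < mu by rewrite powR_gt0.
have muE : lam * (lam ^+ 2)^-1 `^ q = mu.
  rewrite -powR_invn // -powRrM mulNr qE.
  rewrite -[X in X * _](powRr1 lam0') -powRD ?lt0r_neq0 ?implybT //.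
  by rewrite opprB addrC subrK.
have P0q : 0 < P0 `^ q by rewrite powR_gt0.
(* Half the gap: the two errors cost a factor [1 + t] and a summand below [t P^q], and
   [(1 + t)(1 - 2t) + t = 1 - 2t^2 <= 1]. *)
pose t := (1 - mu) / 2.
have t0 : 0 < t by rewrite divr_gt0 // subr_gt0.
have tE : mu = 1 - 2 * t by rewrite /t; field.
clearbody t.
have K1 : 0 < K + 1 by rewrite ltr_wpDl.
(* The first bound gives [e + P <= (1 + t) P], the second [e * K < t P0^q]; [K + 1] allows [K = 0]
   and makes the latter strict. *)
exists (Num.min (P0 * t) (P0 `^ q * t / (K + 1))).
  by rewrite lt_min (mulr_gt0 P00 t0) (divr_gt0 (mulr_gt0 P0q t0) K1).
move=> e P /andP[e0]; rewrite le_min => /andP[eP eK] PP.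
have Pp : 0 < P by exact: lt_le_trans PP.
have [e0' Pp' t0' mu0'] : [/\ 0 <= e, 0 <= P, 0 <= t & 0 <= mu].
  by split; exact: ltW.
have Pq : P0 `^ q <= P `^ q by apply: ge0_ler_powR; rewrite ?nnegrE.
rewrite powRM ?addr_ge0 ?invr_ge0 ?exprn_ge0 // mulrCA muE.
have H1 : (e + P) `^ q <= (1 + t) * P `^ q.
  apply: (@le_trans _ _ (((1 + t) * P) `^ q)).
    apply: ge0_ler_powR; rewrite ?nnegrE ?addr_ge0 ?mulr_ge0 ?addr_ge0 //.
    by rewrite mulrDl mul1r addrC lerD2l (le_trans eP) // mulrC ler_pM2l.
  rewrite powRM ?addr_ge0 // ler_pM2r ?powR_gt0 //.
  by apply: ler1_powR; rewrite // lerDl.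
have H2 : e * K < P `^ q * t.
  apply: (@lt_le_trans _ _ (P0 `^ q * t)); last by rewrite ler_pM2r.
  by move: eK; rewrite ler_pdivlMr //; apply: lt_le_trans; rewrite mulrDr mulr1 ltrDl.
have H3 : (e + P) `^ q * mu <= (1 + t) * P `^ q * mu by rewrite ler_pM2r.
have X0 : 0 < P `^ q by rewrite powR_gt0.
move: H2 H3 X0; rewrite tE.
move: (P `^ q) ((e + P) `^ q) (e * K) => X Y Z H2 H3 X0.
have : 0 <= t * t * X by rewrite !mulr_ge0 // ltW.
nra.
Qed.

(** * Existence of a maximum and choice of the penalty constant *)

Lemma compact_closure (R : realType) (d : nat) (A : set 'rV[R]_d) :
  bounded_set A -> compact (closure A).
Proof.
move=> [M [Mreal AM]]; apply: bounded_closed_compact; last exact: closed_closure.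
exists (M + 1); split; first by rewrite realD.
move=> N MN x Ax; apply: le_trans (ltW MN).
have : A `<=` closed_ball_ Num.Def.normr 0 (M + 1).
  by move=> y Ay; rewrite /closed_ball_ /= sub0r normrN; apply: AM => //; rewrite ltrDl.
by move/closureS/(_ _ Ax)/closed_closed_ball_; rewrite /closed_ball_ /= sub0r normrN.
Qed.

Lemma continuous_penalty (R : realType) (d : nat) (M : R) (m : nat) :
  continuous (@penalty R d M m).
Proof.
move=> z.
have c : continuous (fun w : 'rV[R]_d => dotv w w).
  rewrite /dotv; apply: continuous_big => [|i _ w]; first exact: add_continuous.
  exact: (cvgM (@coord_continuous R 1 d 0 i w) (@coord_continuous R 1 d 0 i w)).
have cX := continuous_comp (c z) (@exprn_continuous _ m.+2 (dotv z z)).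
exact: (cvgM (cvg_cst M) cX).
Qed.

Lemma exists_doubling_max (R : realType) (d : nat) (A : set 'rV[R]_d)
    (f g : 'rV[R]_d -> R) (lam M : R) (m : nat) (x0 : 'rV[R]_d) :
  compact A -> A x0 -> {within A, continuous f} -> {within A, continuous g} ->
  exists x y, [/\ A x, A y & forall x' y', A x' -> A y' ->
    lam * f x' - g y' - penalty M m (x' - y') <=
    lam * f x - g y - penalty M m (x - y)].
Proof.
move=> cA Ax0 cf cg.
pose Phi z : R := lam * f z.1 - g z.2 - penalty M m (z.1 - z.2).
have cPhi : {within A `*` A, continuous Phi}.
  apply/subspace_continuousP => -[x y] [/= Ax Ay].
have cfst : fst @ within (A `*` A) (nbhs (x, y)) --> within A (nbhs x).
  move=> P nP; exists ([set t | A t -> P t], setT).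
    by split; [exact: nP|exact: filterT].
  by move=> [a b] [/= H _] [Aa _]; exact: H.
have csnd : snd @ within (A `*` A) (nbhs (x, y)) --> within A (nbhs y).
  move=> P nP; exists (setT, [set t | A t -> P t]).
    by split; [exact: filterT|exact: nP].
  by move=> [a b] [/= _ H] [_ Ab]; exact: H.
move/subspace_continuousP : cf => /(_ x Ax) cf.
move/subspace_continuousP : cg => /(_ y Ay) cg.
have cz : (fun z : 'rV[R]_d * 'rV[R]_d => z.1 - z.2) @
    within (A `*` A) (nbhs (x, y)) --> x - y.
  by apply: cvg_within_filter; apply: cvgB; [exact: cvg_fst|exact: cvg_snd].
have cp := cvg_comp _ _ cz (@continuous_penalty R d M m (x - y)).
exact: (cvgB (cvgB (cvgM (cvg_cst lam) (cvg_comp _ _ cfst cf))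
  (cvg_comp _ _ csnd cg)) cp).
have [] := compact_EVT_max _ (compact_setX cA cA) cPhi; first by exists (x0, x0).
move=> [x y] /set_mem[/= Ax Ay] H; exists x, y; split => // x' y' Ax' Ay'.
by apply: (H (x', y')); rewrite inE.
Qed.

(** For [|z| < rho] the linear term alone is below [eta]; for [|z| >= rho] the choice of [M] makes
    the penalty at least [(C + 1) |z|]. This will exclude boundary maxima. *)
Lemma penalty_dominates (R : realType) (d : nat) (C eta : R) (m : nat) :
  0 <= C -> 0 < eta -> exists2 M : R, 0 < M & forall z : 'rV[R]_d,
    C * enorm z - penalty M m z < eta.
Proof.
move=> C0 eta0.
have C1 : 0 < C + 1 by rewrite ltr_wpDl.
pose rho := eta / (C + 1).
have rho0 : 0 < rho by rewrite divr_gt0.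
exists ((C + 1) / rho ^+ (2 * m).+3); first by rewrite divr_gt0 // exprn_gt0.
move=> z; have r0 : 0 <= enorm z by rewrite sqrtr_ge0.
rewrite /penalty -enorm_sqr -exprM; set r := enorm z in r0 *; clearbody r.
have [rr|rr] := ltP r rho.
  rewrite ltrBlDr ltr_wpDr //.
    by rewrite mulr_ge0 ?exprn_ge0 // divr_ge0 ?exprn_ge0 ?(ltW rho0) ?(ltW C1).
  move: rr; rewrite /rho ltr_pdivlMr // mulrDr mulr1 mulrC; apply: le_lt_trans.
  by rewrite lerDl.
have -> : (2 * m.+2)%N = (2 * m).+3.+1 by rewrite !mul2n !doubleS.
rewrite [r ^+ _]exprS mulrCA (le_lt_trans _ eta0) // subr_le0 mulrC ler_wpM2l //.
rewrite mulrAC ler_pdivlMr ?exprn_gt0 //.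
have rho0' := ltW rho0; clearbody rho.
apply: ler_pM; rewrite ?exprn_ge0 ?lerDl //.
by rewrite lerXn2r ?nnegrE.
Qed.

(** * Comparison of two regularized solutions *)

(** As [D <= e], the difference of the reciprocals is nonnegative, so an upper bound on [Q]
    suffices. Replacing [D] by 0 leaves [e * (B / (e + P))]. *)
Lemma inv_add_sub_le (R : realType) (D e P B Q : R) :
  0 < D <= e -> 0 < P -> 0 <= B -> Q <= B * P ->
  Q / (D + P) - Q / (e + P) <= e * (B / P).
Proof.
move=> /andP[D0 De] P0 B0 QB.
have e0 : 0 < e by exact: lt_le_trans De.
have DP : 0 < D + P by exact: addr_gt0.
have eP : 0 < e + P by exact: addr_gt0.
rewrite -mulrBr.
apply: (@le_trans _ _ (B * P * ((D + P)^-1 - (e + P)^-1))).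
  by rewrite ler_wpM2r // subr_ge0 lef_pV2 ?posrE // lerD2r.
apply: (@le_trans _ _ (B * P * (P^-1 - (e + P)^-1))).
  rewrite ler_wpM2l ?mulr_ge0 ?(ltW P0) // lerD2r lef_pV2 ?posrE //.
  by rewrite lerDr ltW.
have -> : B * P * (P^-1 - (e + P)^-1) = e * (B / (e + P)).
  by field; rewrite !lt0r_neq0.
rewrite ler_pM2l // ler_wpM2l // lef_pV2 ?posrE // lerDr.
exact: ltW.
Qed.

(** The threshold [e0] is fixed before the parameters and the solutions, and [del] may be
    arbitrarily small compared with [eps]; this lets two unrelated approximating sequences be
    compared. *)
Lemma regularized_comparison (R : realType) (k lam C eta : R) (d : nat)
    (Omega : set 'rV[R]_d) :
  1 <= k -> open Omega -> bounded_set Omega ->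
  0 < lam < 1 -> 0 <= C -> 0 < eta ->
  exists2 e0 : R, 0 < e0 & forall (eps del : R) (f g : 'rV[R]_d -> R),
    0 < eps <= e0 -> 0 < del <= lam * eps ->
    regularized_solution k eps Omega f -> regularized_solution k del Omega g ->
    C01_bounded (closure Omega) C f -> C01_bounded (closure Omega) C g ->
    forall x, closure Omega x -> lam * f x - g x < eta.
Proof.
move=> k1 oO bO /andP[lam0 lam1] C0 eta0.
pose m := (Num.truncn k).+1.
have km : k <= m%:R by rewrite ltW // truncnS_gt.
have [M M0 Mdom] := penalty_dominates d m C0 eta0.
pose c : R := m.*2.+3%:R.
have c0 : 0 < c by rewrite ltr0n.
(* The trace of the identity is [d]; [d.+1] keeps the constant positive for every [d]. *)
have [a0 a00 Ha0] := @slope_lower_bound R k M (d.+1%:R * c) m k1 km M0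
  (mulr_gt0 (ltr0Sn R d) c0).
have kap0 : 0 < slope M m a0 by exact: slope_gt0.
pose K := c / (slope M m a0 * a0).
have K0 : 0 <= K by rewrite ltW // divr_gt0 // mulr_gt0.
have P00 : 0 < slope M m a0 ^+ 2 * a0 by rewrite mulr_gt0 // exprn_gt0.
have lam01 : 0 < lam < 1 by rewrite lam0.
have [e1 e10 He1] := perturbed_power_lt k1 lam01 P00 K0.
(* With [eps <= 1], the error [(lam * eps) ^+ 2] is at most [eps], hence at most [e1]. *)
exists (Num.min 1 e1); first by rewrite lt_min ltr01.
move=> eps del f g /andP[eps0]; rewrite le_min => /andP[eps1 epse].
move=> /andP[del0 dele] solf solg [_ lipf] [_ lipg] x0 Ox0.
rewrite ltNge; apply/negP => big.
have [[cf sf _] _ bf] := solf; have [[cg sg _] _ bg] := solg.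
have [x [y [Ox Oy xymax]]] :=
  exists_doubling_max lam M m (compact_closure bO) Ox0 cf cg.
have big' : eta <= lam * f x - g y - penalty M m (x - y).
  apply: le_trans (xymax _ _ Ox0 Ox0); apply: le_trans big _.
  by rewrite subrr /penalty -(scale0r 0) dotvZl mul0r expr0n /= mulr0 subr0.
have bnd z : closure Omega z -> ~ Omega z -> boundary Omega z.
  by move=> cz nz; split => // /interior_subset.
have {}Ox : Omega x.
  (* If [x] is a boundary point, then [f x = g x = 0] and [lam * f x - g y = g x - g y], which the
     Lipschitz bound and [Mdom] control. *)
  apply: contrapT => /(bnd _ Ox) bx; move: big'; rewrite leNgt => /negP; apply.
  apply: le_lt_trans (Mdom (x - y)); rewrite lerD2r (bf _ bx) mulr0.
  by rewrite -(bg _ bx) (le_trans (ler_norm _)) // lipg //; apply: bx.1.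
have {}Oy : Omega y.
  apply: contrapT => /(bnd _ Oy) bdy; move: big'; rewrite leNgt => /negP; apply.
  apply: le_lt_trans (Mdom (x - y)); rewrite lerD2r (bg _ bdy) subr0.
  have fx : f x <= C * enorm (x - y).
    rewrite -[f x]subr0 -(bf _ bdy) (le_trans (ler_norm _)) // lipf //.
    exact: subset_closure.
  apply: le_trans (_ : lam * (C * enorm (x - y)) <= _); first by rewrite ler_pM2l.
  by rewrite ler_piMl ?(ltW lam1) // mulr_ge0 // sqrtr_ge0.
have D := doubling_max oO sf sg Ox Oy (ltW M0)
  (fun x' y' Ox' Oy' => xymax x' y' (subset_closure Ox') (subset_closure Oy')).
have {solf} eqF := regularized_equation eps0 solf Ox.
have {solg} eqG := regularized_equation del0 solg Oy.
move: (hessian f x) (hessian g y) (grad f x) (grad g y) (x - y) D eqF eqG.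
move=> Hf Hg Gf Gg z D eqF eqG.
set a := dotv z z in D.
have a_ge0 : 0 <= a by exact: dotv_ge0.
have [kap kapE] : exists kap, kap = slope M m a by exists (slope M m a).
rewrite -kapE in D.
have kap_ge0 : 0 <= kap by rewrite kapE slope_ge0 // ltW.
have ck0 : 0 <= c * kap by rewrite mulr_ge0 // ltW.
have dot0 (v : 'rV[R]_d) : dotv 0 v = 0 by rewrite -(scale0r 0) dotvZl mul0r.
have q0 (H : 'M[R]_d) : qform H 0 = 0 by rewrite /qform !mul0mx mxE.
have qN (H : 'M[R]_d) v : qform (- H) v = - qform H v.
  by rewrite -scaleN1r qformZ mulN1r.
have [p pE] : exists p, p = kap *: z by exists (kap *: z).
have gradf : lam *: Gf = p.
  apply/rowP => i; have [+ _] := D (delta_mx 0 i) 0.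
  by rewrite dot0 !subr0 !dotv_deltal pE !mxE.
have gradg : Gg = p.
  apply/rowP => i; have [+ _] := D 0 (delta_mx 0 i).
  rewrite dot0 mulr0 !sub0r -[- delta_mx 0 i]scaleN1r dotvZl !dotv_deltal pE !mxE.
  by rewrite mulN1r mulrN => /oppr_inj.
(* The three Hessian bounds come from the directions [(v, 0)], [(0, v)] and [(v, v)]; the last
   leaves [x - y], hence the penalty, unchanged. *)
have XB v : lam * qform Hf v <= c * kap * dotv v v.
  by have [_] := D v 0; rewrite q0 !subr0.
have YB v : - (c * kap * dotv v v) <= qform Hg v.
  have [_] := D 0 v; rewrite q0 mulr0 !sub0r -[- v]scaleN1r dotvZl dotvC dotvZl.
  by rewrite !mulN1r opprK lerNl.
have XY v : lam * qform Hf v <= qform Hg v.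
  by have [_] := D v v; rewrite subrr dot0 mulr0 subr_le0.
have [P PE] : exists P, P = dotv p p by exists (dotv p p).
have pp : P = kap ^+ 2 * a.
  by rewrite PE pE dotvZl dotvC dotvZl mulrA -expr2.
have P_ge0 : 0 <= P by rewrite PE dotv_ge0.
clearbody a.
have [q qE] : exists q, q = 2^-1 - (2 * k)^-1 by exists (2^-1 - (2 * k)^-1).
have qge0 : 0 <= q.
  have k0 : 0 < k by exact: lt_le_trans k1.
  by rewrite qE subr_ge0 lef_pV2 ?posrE ?mulr_gt0 // ler_peMr.
have [w wE] : exists w, w = del ^+ 2 + P by exists (del ^+ 2 + P).
have w0 : 0 < w by rewrite wE ltr_pwDl // exprn_gt0.
have Pw : P <= w by rewrite wE lerDr exprn_ge0 // ltW.
have eqg : \tr Hg - qform Hg p / w = - w `^ q.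
  by move: eqG; rewrite /= gradg -PE -wE -qE.
have lamn0 := lt0r_neq0 lam0.
(* Since [Gf = p / lam], the radicand [eps^2 + |Gf|^2] equals [(e + P) / lam^2]. *)
have [e eE] : exists e, e = (lam * eps) ^+ 2 by exists ((lam * eps) ^+ 2).
have e0 : 0 < e by rewrite eE exprn_gt0 // mulr_gt0.
have gradf' : Gf = lam^-1 *: p by rewrite -gradf scalerA mulVf ?scale1r.
have eqf : lam * \tr Hf - lam * qform Hf p / (e + P) =
    - (lam * ((e + P) / lam ^+ 2) `^ q).
  move: eqF; rewrite /= gradf' dotvZl dotvC dotvZl -PE qform_scale -qE.
  have -> : eps ^+ 2 + lam^-1 * (lam^-1 * P) = (e + P) / lam ^+ 2.
    by rewrite eE; field.
  move=> /(congr1 ( *%R lam)); rewrite mulrN => <-.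
  by field; rewrite lamn0 /= lt0r_neq0 // ltr_wpDr.
(* Adding [c * kap] times the identity makes [Hg] nonnegative, so the projection inequality bounds
   the left side of the equation for [g] from below. *)
have traceY : w `^ q <= d.+1%:R * c * kap.
  have H v : 0 <= qform (Hg + (c * kap) *: 1%:M) v.
    by rewrite qformD qformZ qform1 -lerBlDr sub0r.
  have := @qform_div_le_mxtrace _ _ _ p w H; rewrite -PE => /(_ Pw).
  rewrite qformD qformZ qform1 mxtraceD mxtraceZ mxtrace1 -PE mulrDl => tr.
  have ckPw : 0 <= c * kap * P / w by rewrite divr_ge0 ?(ltW w0) ?mulr_ge0.
  rewrite -addn1 natrD -mulrA mulrDl mul1r.
  lra.
have aa0 : a0 <= a.
  by apply: (Ha0 a w) => //; rewrite -kapE -?pp -?qE.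
have a_gt0 : 0 < a by exact: lt_le_trans aa0.
have kapk : slope M m a0 <= kap.
  rewrite kapE /slope ler_wpM2l ?mulr_ge0 ?(ltW M0) // lerXn2r // nnegrE.
  exact: ltW.
have kap_gt0 : 0 < kap by exact: lt_le_trans kapk.
have P_gt0 : 0 < P by rewrite pp mulr_gt0 // exprn_gt0.
have PP : slope M m a0 ^+ 2 * a0 <= P.
  rewrite pp ler_pM ?exprn_ge0 ?(ltW a00) ?(ltW kap0) //.
  by rewrite lerXn2r // nnegrE ltW.
have dele2 : del ^+ 2 <= e.
  by rewrite eE lerXn2r // nnegrE ltW // mulr_gt0.
have ee1 : 0 < e <= e1.
  have le0 : 0 <= lam * eps by rewrite mulr_ge0 ?ltW.
  have leps : lam * eps <= eps by rewrite ler_piMl ?ltW.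
  rewrite e0 /= (le_trans _ epse) // (le_trans _ leps) // eE expr2.
  by rewrite ler_piMl // (le_trans leps).
(* Ellipticity applied to [Hg - lam *: Hf], with the denominator [w] of [g] for both Hessians; [dw]
   pays for replacing [e + P] by [w] in the term of [f]. *)
have traceXY : (qform Hg p - lam * qform Hf p) / w <= \tr Hg - lam * \tr Hf.
  rewrite -mxtraceZ -qformZ -qN -qformD -raddfB /=.
  apply: qform_div_le_mxtrace; rewrite -?PE // => v.
  by rewrite qformD qN qformZ subr_ge0.
have := He1 e P ee1 PP; rewrite ltNge -qE => /negP; apply.
(* [Hf] is controlled from above only, so the error must carry the nonnegative
   factor [1 / w - 1 / (e + P)]: this is where [del <= lam * eps] is needed. *)
have dw : lam * qform Hf p / w - lam * qform Hf p / (e + P) <=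
    e * (c * kap / P).
  rewrite wE; apply: inv_add_sub_le => //; first by rewrite exprn_gt0.
  by rewrite PE.
have cK : c * kap / P <= K.
  have -> : c * kap / P = c / (kap * a).
    by rewrite pp; field; rewrite !lt0r_neq0.
  rewrite /K ler_wpM2l ?(ltW c0) // lef_pV2 ?posrE;
    [|exact: mulr_gt0|exact: mulr_gt0].
  by rewrite ler_pM ?(ltW a00) ?(ltW kap0).
have eK : e * (c * kap / P) <= e * K.
  by rewrite ler_wpM2l // ltW.
have Pwq : P `^ q <= w `^ q.
  by apply: ge0_ler_powR => //; rewrite ?nnegrE ?(ltW w0).
rewrite mulrBl in traceXY.
lra.
Qed.

(** * Passage to the limit and uniqueness *)

Lemma weak_Hk_flow_le (R : realType) (k : R) (d : nat)
    (Omega : set 'rV[R]_d) (u v : 'rV[R]_d -> R) :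
  1 <= k -> open Omega -> bounded_set Omega ->
  weak_Hk_flow k Omega u -> weak_Hk_flow k Omega v ->
  forall x, closure Omega x -> u x <= v x.
Proof.
move=> k1 oO bO [_ [eps [ue [eps0 epsc sole [C1 lipe] ueu]]]].
move=> [_ [del [ve [del0 delc sold [C2 lipd] vev]]]] x Ox.
have ptw (F : nat -> 'rV[R]_d -> R) f : {uniform closure Omega, F @ \oo --> f} ->
    F i x @[i --> \oo] --> f x.
  have xO : [set x] `<=` closure Omega by move=> _ ->.
  by move=> /(uniform_subset_cvg _ xO); rewrite uniform_set1.
have {}ueu := ptw _ _ ueu; have {}vev := ptw _ _ vev.
rewrite leNgt; apply/negP => vu.
pose h := u x - v x.
have h0 : 0 < h by rewrite subr_gt0.
have u1 : 0 < `|u x| + 1 by rewrite ltr_wpDl.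
(* Small enough that [lam = 1 - s] lies in [(0, 1)] and scaling [u x] by [lam] loses at most half of
   the gap [h]. *)
pose s := Num.min (1 / 2) (h / (2 * (`|u x| + 1))).
have s0 : 0 < s by rewrite lt_min divr_gt0 //= divr_gt0 // mulr_gt0.
have s1 : s < 1.
  by rewrite (le_lt_trans (_ : _ <= 1 / 2)) ?ge_min ?lexx // ltr_pdivrMr // mul1r ltr1n.
have su : s * `|u x| <= h / 2.
  apply: (@le_trans _ _ (s * (`|u x| + 1))); first by rewrite ler_pM2l // lerDl.
  by rewrite -ler_pdivlMr // -mulrA -invfM /s ge_min lexx orbT.
pose lam := 1 - s.
have lam01 : 0 < lam < 1 by rewrite subr_gt0 s1 ltrBlDr ltrDl s0.
have [lam0 lam1] := andP lam01.
have lamh : h / 2 <= lam * u x - v x.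
  have su' : s * u x <= s * `|u x| by rewrite ler_pM2l // ler_norm.
  have -> : lam * u x = u x - s * u x by rewrite /lam mulrBl mul1r.
  rewrite /h in su *; lra.
have C1_ge0 : 0 <= C1 by exact: le_trans (normr_ge0 _) ((lipe 0%N).1 x Ox).
have C2_ge0 : 0 <= C2 by exact: le_trans (normr_ge0 _) ((lipd 0%N).1 x Ox).
have widen C C' w : C <= C' -> C01_bounded (closure Omega) C w ->
    C01_bounded (closure Omega) C' w.
  move=> CC [b l]; split=> [y Oy|y z Oy Oz]; first exact: le_trans (b y Oy) CC.
  by rewrite (le_trans (l y z Oy Oz)) // ler_wpM2r // sqrtr_ge0.
have h8 : 0 < h / 8 by rewrite divr_gt0.
have [e0 e00 cmp] := regularized_comparison k1 oO bO lam01
  (addr_ge0 C1_ge0 C2_ge0) h8.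
(* The index [i] is chosen first, then [j] with [del j <= lam * eps i]. The two approximation errors
   and the comparison cost [h / 8] each, in total less than [h / 2]. *)
have [i [ei ui]] : exists i, eps i <= e0 /\ `|u x - ue i x| < h / 8.
  have near_i : \forall i \near \oo, eps i <= e0 /\ `|u x - ue i x| < h / 8.
    near=> i; split.
      by near: i; exact: (cvgr_le 0).
    by near: i; exact: cvgr_dist_lt.
  by case: near_i => N _ /(_ N (leqnn N)) H; exists N.
have lame : 0 < lam * eps i by rewrite mulr_gt0.
have [j [dj vj]] : exists j, del j <= lam * eps i /\ `|v x - ve j x| < h / 8.
  have near_j : \forall j \near \oo,
      del j <= lam * eps i /\ `|v x - ve j x| < h / 8.
    near=> j; split.
      by near: j; exact: (cvgr_le 0).
    by near: j; exact: cvgr_dist_lt.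
  by case: near_j => N _ /(_ N (leqnn N)) H; exists N.
have : lam * ue i x - ve j x < h / 8.
  apply: (cmp (eps i) (del j)) => //.
  - by rewrite eps0.
  - by rewrite del0.
  - by apply: widen (lipe i); rewrite lerDl.
  - by apply: widen (lipd j); rewrite lerDr.
move: vj; rewrite ltr_norml => /andP[vj _] cmpx.
have lu : lam * (u x - ue i x) <= h / 8.
  apply: le_trans (ltW ui); apply: le_trans (ler_norm _) _.
  by rewrite normrM gtr0_norm // ler_piMl // ltW.
rewrite mulrBr in lu.
lra.
Unshelve. all: by end_near. Qed.

Theorem corollary4p5 (R : realType) (k : R) (n : nat)
  (Omega : set 'rV[R]_n.+1)
  (hk : 1 <= k) (hn : (n <= 6)%N)
  (hopen : open Omega) (hbounded : bounded_set Omega)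
  (hsmooth : smooth_boundary Omega)
  (hmean : positive_mean_curvature Omega)
  (u v : 'rV[R]_n.+1 -> R)
  (hu : weak_Hk_flow k Omega u) (hv : weak_Hk_flow k Omega v) :
  forall x, closure Omega x -> u x = v x.
Proof.
move=> x Ox; apply/le_anti/andP.
by split; [exact: weak_Hk_flow_le hu hv x Ox|exact: weak_Hk_flow_le hv hu x Ox].
Qed.
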